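(* Let $G$ be a group, $R$ a commutative ring with unit and $\mathscr G$ a Hausdorff ample $G$-graded groupoid. Then the graded normalizer $N=\bigcup_{g\in G}N_g$ of the diagonal subalgebra $D(\mathscr G)$ is a $G$-graded inverse semigroup under the multiplication of $R\mathscr G$, where the grading sends a non-zero element of $N_g$ to $g$.
   Context: Inverse semigroups. An inverse semigroup is a semigroup $S$ such that for each $s\in S$ there is a unique $s^*\in S$ with $ss^*s=s$ and $s^*ss^*=s^*$. A $G$-graded inverse semigroup is an inverse semigroup $S$ with zero together with a map $\theta\colon S\setminus\{0\}\to G$ (the grading) such that $\theta(st)=\theta(s)\theta(t)$ whenever $st\neq 0$. Groupoids. A groupoid $\mathscr G$ is a small category with all arrows invertible; $\mathscr G^{(0)}$ is the set of objects (identified with the identity arrows), $\mathscr G^{(1)}$ the set of arrows, $\boldsymbol d,\boldsymbol r$ the domain and range maps; $\alpha\beta$ is defined when $\boldsymbol d(\alpha)=\boldsymbol r(\beta)$. A topological groupoid has topologies making all structure maps continuous; it is étale if $\boldsymbol d$ is a local homeomorphism (then all structure maps are, and $\mathscr G^{(0)}$ is open in $\mathscr G^{(1)}$). A Boolean space is a Hausdorff space with a basis of compact open sets. An ample groupoid is an étale groupoid with $\mathscr G^{(0)}$ a Boolean space; it is Hausdorff if $\mathscr G^{(1)}$ is Hausdorff. A $G$-graded groupoid is a topological groupoid with a continuous functor (cocycle) $c\colon\mathscr G\to G$, $G$ being a discrete one-object groupoid; $\mathscr G_g=c^{-1}(g)$. Groupoid algebra. $R\mathscr G$ is the $R$-module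 of compactly supported locally constant functions $\mathscr G^{(1)}\to R$ with product $fg(\gamma)=\sum_{\boldsymbol d(\alpha)=\boldsymbol d(\gamma)}f(\gamma\alpha^{-1})g(\alpha)$. It is $G$-graded, the component $R\mathscr G_g$ consisting of the functions supported on $\mathscr G_g$. The diagonal subalgebra $D(\mathscr G)$ is the set of functions supported on $\mathscr G^{(0)}$. Normalizer. For $g\in G$, $N_g$ is the set of $m\in R\mathscr G_g$ for which there is $m'\in R\mathscr G_{g^{-1}}$ with $mm'm=m$, $m'mm'=m'$ and $mD(\mathscr G)m'\cup m'D(\mathscr G)m\subseteq D(\mathscr G)$. *)

(* Defs.v *)
From mathcomp Require Import all_boot all_algebra all_classical.
From mathcomp Require Import topology.

Set Implicit Arguments.
Unset Strict Implicit.
Unset Printing Implicit Defensive.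

Import GRing.Theory.
Local Open Scope classical_set_scope.
Local Open Scope ring_scope.

(* Partial operations are total functions whose values matter only on the
   indicated subset: multiplication on a subset [S] of a type, composition of
   arrows on composable pairs, gradings on nonzero elements. *)

Definition inverse_semigroup (T : Type) (S : set T) (op : T -> T -> T) : Prop :=
  [/\ forall s t, S s -> S t -> S (op s t),
      forall s t u, S s -> S t -> S u -> op s (op t u) = op (op s t) u
    & forall s, S s ->
        exists! s', [/\ S s', op (op s s') s = s & op (op s' s) s' = s']].

Definition graded_inverse_semigroup (G : groupType) (T : Type) (S : set T)
    (op : T -> T -> T) (z : T) (theta : T -> G) : Prop :=
  [/\ inverse_semigroup S op,
      S z,
      forall s, S s -> op z s = z /\ op s z = z
    & forall s t, S s -> S t -> op s t <> z ->
        theta (op s t) = (theta s * theta t)%g].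

(* [gcomp a b] is the composite "a after b", defined when [gdom a = gcod b]. *)
Record topGroupoid := TopGroupoid {
  gobj : topologicalType ;
  garr : topologicalType ;
  gdom : garr -> gobj ;
  gcod : garr -> gobj ;
  gid : gobj -> garr ;
  ginv : garr -> garr ;
  gcomp : garr -> garr -> garr ;
  gdom_id : forall x, gdom (gid x) = x ;
  gcod_id : forall x, gcod (gid x) = x ;
  gdom_comp : forall a b, gdom a = gcod b -> gdom (gcomp a b) = gdom b ;
  gcod_comp : forall a b, gdom a = gcod b -> gcod (gcomp a b) = gcod a ;
  gcompA : forall a b e, gdom a = gcod b -> gdom b = gcod e ->
    gcomp a (gcomp b e) = gcomp (gcomp a b) e ;
  gcomp_idr : forall a, gcomp a (gid (gdom a)) = a ;
  gcomp_idl : forall a, gcomp (gid (gcod a)) a = a ;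
  gdom_inv : forall a, gdom (ginv a) = gcod a ;
  gcod_inv : forall a, gcod (ginv a) = gdom a ;
  gcomp_invr : forall a, gcomp a (ginv a) = gid (gcod a) ;
  gcomp_invl : forall a, gcomp (ginv a) a = gid (gdom a) ;
  gdom_continuous : continuous gdom ;
  gcod_continuous : continuous gcod ;
  gid_continuous : continuous gid ;
  ginv_continuous : continuous ginv ;
  gcomp_continuous :
    {within [set p : garr * garr | gdom p.1 = gcod p.2],
      continuous (fun p : garr * garr => gcomp p.1 p.2)}
}.

Definition local_homeomorphism (X Y : topologicalType) (f : X -> Y) : Prop :=
  forall x, exists U : set X,
    [/\ open U, U x, open (f @` U), {within U, continuous f}
      & exists2 h : Y -> X, {in U, cancel f h} &
          {within f @` U, continuous h}].

Definition etale (Gr : topGroupoid) : Prop := local_homeomorphism (@gdom Gr).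

Definition boolean_space (X : topologicalType) : Prop :=
  hausdorff_space X /\ basis [set U : set X | compact U /\ open U].

Definition ample (Gr : topGroupoid) : Prop :=
  etale Gr /\ boolean_space (gobj Gr).

Definition cocycle (G : groupType) (Gr : topGroupoid) (c : garr Gr -> G) : Prop :=
  [/\ continuous (c : garr Gr -> discrete_topology G),
      forall x, c (gid x) = 1%g
    & forall a b, gdom a = gcod b -> c (gcomp a b) = (c a * c b)%g].

Definition locally_constant (X : topologicalType) (T : Type) (f : X -> T) :=
  forall x, \forall y \near x, f y = f x.

Section GroupoidAlgebra.
Context (R : comPzRingType) (Gr : topGroupoid).
Implicit Types f g m : garr Gr -> R.

Definition fsupp f : set (garr Gr) := [set a | f a != 0].

Definition groupoid_algebra : set (garr Gr -> R) :=
  [set f | locally_constant f /\ compact (closure (fsupp f))].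

(* The sum has finite support when [Gr] is Hausdorff ample and [f], [g] are in
   the groupoid algebra; an infinitely supported sum would be 0. *)
Definition conv f g : garr Gr -> R := fun y =>
  \sum_(a \in [set a | gdom a = gdom y]) f (gcomp y (ginv a)) * g a.

Definition diagonal : set (garr Gr -> R) :=
  [set f | groupoid_algebra f /\ fsupp f `<=` range (@gid Gr)].

Context (G : groupType) (c : garr Gr -> G).

Definition homogeneous (g : G) : set (garr Gr -> R) :=
  [set f | groupoid_algebra f /\ fsupp f `<=` c @^-1` [set g]].

Definition normalizer_at (g : G) : set (garr Gr -> R) :=
  [set m | homogeneous g m /\
    exists m', [/\ homogeneous (g^-1)%g m',
      conv (conv m m') m = m,
      conv (conv m' m) m' = m'
    & [set conv (conv m d) m' | d in diagonal] `|`
      [set conv (conv m' d) m | d in diagonal] `<=` diagonal]].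

Definition graded_normalizer : set (garr Gr -> R) :=
  \bigcup_(g in [set: G]) normalizer_at g.

End GroupoidAlgebra.

(* Main.v *)
(* A regular semigroup with commuting idempotents is inverse.  If m' is
   attached to m in the definition of N_g, inserting a local unit d in D
   with md = m gives mm' = mdm' in D, and likewise m'm in D.  As D is
   commutative, m'm commutes with nn', so n'm' is attached to mn and N is
   closed under products.  If e = ee in N has e' attached, then
   e' = (e'e)(ee') is a product of commuting idempotents of D, so e' is an
   idempotent of D and e = (ee')(e'e) is in D too; hence idempotents of N
   commute.

   For f, g in the groupoid algebra, the support of g meets the d-fiber of a
   point in finitely many arrows, and over nearby points the fiber of the
   support is traced out by disjoint local sections of d through these
   arrows; so fg is locally constant. *)
From mathcomp Require Import all_boot all_algebra all_classical.
From mathcomp Require Import topology.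
Require Import Defs.

Set Implicit Arguments.
Unset Strict Implicit.
Unset Printing Implicit Defensive.

Import GRing.Theory.
Local Open Scope classical_set_scope.
Local Open Scope ring_scope.

(** * Preliminaries from topology, and a criterion for inverse semigroups *)

Lemma near_finite_forall (T : Type) (I : choiceType) (F : set_system T)
    (A : set I) (P : I -> T -> Prop) : Filter F -> finite_set A ->
  (forall a, A a -> \forall x \near F, P a x) ->
  \forall x \near F, forall a, A a -> P a x.
Proof.
move=> FF Afin AP.
have := @filter_bigI _ _ (fset_set A) P F FF; rewrite fset_setK //.
by apply=> a; rewrite in_fset_set // inE; apply: AP.
Qed.

(** If [A] were infinite, the sets containing all but finitely many of its points would form a
    proper filter; at a cluster point [a] in [A], its member [A] minus [a] would miss a
    neighbourhood of [a]. *)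
Lemma compact_discrete_finite (T : topologicalType) (A : set T) : compact A ->
  (forall a, A a -> \forall b \near a, A b -> b = a) -> finite_set A.
Proof.
move=> Ac Ad; apply: contrapT => Ainf.
pose F : set_system T := [set S | finite_set (A `\` S)].
have FF : ProperFilter F.
  split=> [|]; first by rewrite /F /= setD0.
  split=> [|S S' | S S' SS']; rewrite /F /= ?setDT ?setDIr ?finite_setU //.
  by apply: sub_finite_set; apply: setDS.
have [|a [Aa aF]] := Ac F FF; first by rewrite /F /= setDv.
have /aF : F (A `\ a).
  by rewrite /F /= setDD; apply: sub_finite_set (finite_set1 a); apply: subIsetr.
by move=> /(_ _ (Ad a Aa)) [b [[Ab ba] /(_ Ab)]].
Qed.

Lemma closed_equalizer (X Y : topologicalType) (u v : X -> Y) :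
  hausdorff_space Y -> continuous u -> continuous v ->
  closed [set z | u z = v z].
Proof.
move=> Yh uc vc; rewrite -openC openE => z /= /eqP uv.
move: Yh; rewrite open_hausdorff => /(_ _ _ uv) [[U V] /= [Uz Vz] [Uo Vo UV]].
rewrite !inE in Uz Vz.
have Un : \forall t \near z, U (u t) by apply: uc; exact: open_nbhs_nbhs.
have Vn : \forall t \near z, V (v t) by apply: vc; exact: open_nbhs_nbhs.
apply: filterS2 Un Vn => t Ut Vt /= e.
suff : (U `&` V) (u t) by rewrite (eqP UV).
by split; rewrite // e.
Qed.

(** Two inverses t, u of s both equal tsu: since the idempotents st and su commute, tsu = t(st)(su)
    = t(su)(st) = tst = t; since ts and us commute, tsu = u. *)
Lemma commuting_idempotents_inverse_semigroup (T : Type) (S : set T)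
    (op : T -> T -> T) :
  (forall s t, S s -> S t -> S (op s t)) ->
  (forall s t u, S s -> S t -> S u -> op s (op t u) = op (op s t) u) ->
  (forall s, S s ->
    exists s', [/\ S s', op (op s s') s = s & op (op s' s) s' = s']) ->
  (forall e f, S e -> S f -> op e e = e -> op f f = f -> op e f = op f e) ->
  inverse_semigroup S op.
Proof.
move=> opS opA reg com; split=> // s Ss.
have [t [St sts tst]] := reg s Ss; exists t; split=> // u [Su sus usu].
have idem a b : S a -> S b -> op (op a b) a = a ->
    op (op a b) (op a b) = op a b.
  by move=> Sa Sb aba; rewrite opA ?aba //; exact: opS.
have [Sst Ssu Sts Sus] : [/\ S (op s t), S (op s u), S (op t s) & S (op u s)].
  by split; exact: opS.
have tE : t = op t (op s u).
  rewrite -[in RHS]tst -[op (op t s) t]opA // -[RHS]opA //.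
  rewrite (com (op s t)) ?idem //.
  by rewrite [op (op s u) _]opA // sus opA.
have uE : u = op (op t s) u.
  rewrite -[in RHS]usu opA // (com (op t s)) ?idem //.
  by rewrite -[op (op u s) _]opA // [op s (op t s)]opA // sts.
by rewrite [LHS]tE [RHS]uE opA.
Qed.

(** * Cancellation in a groupoid *)

Section Groupoid.
Context (Gr : topGroupoid).
Implicit Types a b y : garr Gr.

Lemma gcompK a b : gdom a = gcod b -> gcomp (gcomp a b) (ginv b) = a.
Proof.
move=> ab; rewrite -gcompA ?gcod_inv // gcomp_invr -ab; exact: gcomp_idr.
Qed.

Lemma gcompVK a b : gdom a = gdom b -> gcomp (gcomp a (ginv b)) b = a.
Proof.
move=> ab; rewrite -gcompA ?gcod_inv ?gdom_inv // gcomp_invl -ab.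
exact: gcomp_idr.
Qed.

Lemma gid_gcomp_inv a b x :
  gdom a = gdom b -> gcomp a (ginv b) = gid x -> a = b.
Proof.
move=> ab e; rewrite -(gcompVK ab) e.
have -> : x = gcod b.
  by rewrite -(gdom_id x) -e gdom_comp ?gcod_inv ?gdom_inv.
exact: gcomp_idl.
Qed.

Lemma ginv_id x : ginv (gid x : garr Gr) = gid x.
Proof.
by rewrite -[LHS]gcomp_idr gdom_inv gcod_id gcomp_invl gdom_id.
Qed.

Lemma gcomp_unit_inv a : gcomp a (ginv (gid (gdom a))) = a.
Proof. by rewrite ginv_id gcomp_idr. Qed.

Lemma gcompI a a' b : gdom a = gcod b -> gdom a' = gcod b ->
  gcomp a b = gcomp a' b -> a = a'.
Proof. by move=> ab a'b e; rewrite -(gcompK ab) e gcompK. Qed.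

Lemma gcomp_ginv_comp y a b : gdom y = gdom a -> gdom b = gcod a ->
  gcomp (gcomp y (ginv a)) (ginv b) = gcomp y (ginv (gcomp b a)).
Proof.
move=> ya ba.
have yai : gdom (gcomp y (ginv a)) = gdom b.
  by rewrite gdom_comp ?gcod_inv // gdom_inv.
have ydba : gdom y = gdom (gcomp b a) by rewrite gdom_comp.
apply: (@gcompI _ _ (gcomp b a));
  rewrite ?gdom_comp ?gdom_inv ?gcod_inv ?gcod_comp //.
by rewrite gcompA ?gdom_comp ?gcod_inv ?gdom_inv // !gcompVK.
Qed.

End Groupoid.

(** * Local sections of the domain map *)

Section Etale.
Context (Gr : topGroupoid) (het : etale Gr).
Implicit Types a b y : garr Gr.

(** The germ at [gdom a] of a local inverse of [gdom] through [a]: [s] is total, but its values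
    matter only near [gdom a], and continuity is asked at that point alone. *)
Definition local_section a (s : gobj Gr -> garr Gr) :=
  [/\ s (gdom a) = a, {for gdom a, continuous s},
      \forall x \near gdom a, gdom (s x) = x
    & \forall b \near a, s (gdom b) = b].

Lemma local_section_ex a : exists s, local_section a s.
Proof.
have [U [Uo Ua dUo _ [h hK hc]]] := het a.
have dUa : nbhs (gdom a) (@gdom Gr @` U).
  by apply: open_nbhs_nbhs; split=> //; exists a.
exists h; split.
- by apply: hK; rewrite inE.
- move/subspace_continuousP: hc => /(_ (gdom a)).
  by rewrite within_interior //; apply; exists a.
- by apply: filterS dUa => _ [b Ub <-]; rewrite hK ?inE.
- have : nbhs a U by exact: open_nbhs_nbhs.
  by apply: filterS => b Ub; rewrite hK ?inE.
Qed.

Lemma gdom_open (O : set (garr Gr)) : open O -> open (@gdom Gr @` O).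
Proof.
rewrite !openE => Oo _ [a Oa <-].
have [s [sa sc ds _]] := local_section_ex a.
have Os : \forall x \near gdom a, O (s x) by apply: sc; rewrite sa; exact: Oo.
by apply: filterS2 Os ds => x Osx <-; exists (s x).
Qed.

(** For [a] near [gid x], both [a] and [gid (gdom a)] lie where a local section inverts [gdom];
    having the same domain, they are equal. *)
Lemma range_gid_open : open (range (@gid Gr)).
Proof.
rewrite openE => _ [x _ <-].
have [s [_ _ _ sd]] := local_section_ex (gid x).
have gc : gid (gdom a) @[a --> (gid x : garr Gr)] --> (gid x : garr Gr).
  rewrite -{2}(gdom_id x); apply: (@cvg_comp _ _ _ (@gdom Gr) (@gid Gr)).
    exact: gdom_continuous.
  exact: gid_continuous.
apply: filterS2 sd (gc _ sd) => a /= sa.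
by rewrite gdom_id sa => ->; exists (gdom a).
Qed.

End Etale.

(** * Convolution of functions with finite fibers *)

Section Convolution.
Context (R : comPzRingType) (Gr : topGroupoid).
Implicit Types (f g h : garr Gr -> R) (a b y : garr Gr) (x : gobj Gr).

Definition fiber x : set (garr Gr) := [set a | gdom a = x].

Definition finite_fibers g := forall x, finite_set (fiber x `&` fsupp g).

Lemma conv_neq0 f g y : conv f g y != 0 ->
  exists a, [/\ gdom a = gdom y, f (gcomp y (ginv a)) != 0 & g a != 0].
Proof.
apply: contraNP => na; apply/eqP; apply: fsbig1 => a /= ay.
apply: contrapT => /eqP fg; apply: na; exists a; split=> //.
  by apply: contra_neq fg => ->; rewrite mul0r.
by apply: contra_neq fg => ->; rewrite mulr0.
Qed.

Lemma conv0f g : conv (fun=> 0) g = (fun=> 0).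
Proof. by apply/funext => y; apply: fsbig1 => a _; rewrite mul0r. Qed.

Lemma convf0 f : conv f (fun=> 0) = (fun=> 0).
Proof. by apply/funext => y; apply: fsbig1 => a _; rewrite mulr0. Qed.

Lemma conv_fsupp f g y : conv f g y =
  \sum_(a \in fiber (gdom y) `&` fsupp g) f (gcomp y (ginv a)) * g a.
Proof.
apply/esym/fsbig_widen; first exact: subIsetl.
move=> a [/= ay /not_andP [] // /negP]; rewrite negbK => /eqP ->.
exact: mulr0.
Qed.

Lemma convA f g h : finite_fibers g -> finite_fibers h ->
  conv f (conv g h) = conv (conv f g) h.
Proof.
move=> gfin hfin; apply/funext => y.
(* Both sides become the sum of f(y e^-1) g(e a^-1) h(a) over e in [E] and a in [A], both finite.
   For fixed a, the terms with e not of the form ba, b in [B a], vanish, and substituting e = ba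
   turns the inner sum into a value of [conv f g]. *)
pose A := fiber (gdom y) `&` fsupp h.
pose B a := fiber (gcod a) `&` fsupp g.
pose E := \bigcup_(a in A) ((fun b => gcomp b a) @` B a).
have Afin : finite_set A := hfin _.
have Efin : finite_set E.
  by apply: bigcup_finite => // a _; apply/finite_image/gfin.
have EA e a : gdom e = gdom y -> A a -> ~ ((fun b => gcomp b a) @` B a) e ->
    g (gcomp e (ginv a)) = 0.
  move=> ey [ay ha] ne; apply: contrapT => /eqP g0; apply: ne.
  have ea : gdom e = gdom a by rewrite ey -ay.
  exists (gcomp e (ginv a)); last exact: gcompVK.
  by split=> //; rewrite /fiber /= gdom_comp ?gcod_inv ?gdom_inv.
have Ey : E `<=` fiber (gdom y).
  by move=> e [a [ay _] [b [bE _] <-]]; rewrite /fiber /= gdom_comp.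
transitivity (\sum_(e \in E) \sum_(a \in A)
    f (gcomp y (ginv e)) * (g (gcomp e (ginv a)) * h a)).
  transitivity (\sum_(e \in E) f (gcomp y (ginv e)) * conv g h e).
    apply/esym/fsbig_widen => // e [/= ey nE].
    rewrite conv_fsupp fsbig1 ?mulr0 // => a; rewrite ey => Aa.
    by rewrite (EA e a) ?mul0r // => eB; apply: nE; exists a.
  apply: eq_fsbigr => e; rewrite inE => /Ey ey.
  by rewrite conv_fsupp ey fsbig_distrr.
rewrite exchange_fsbig // [RHS]conv_fsupp.
apply: eq_fsbigr => a; rewrite inE => -[ay ha].
have gya : gdom (gcomp y (ginv a)) = gcod a.
  by rewrite gdom_comp ?gcod_inv ?gdom_inv.
transitivity (\sum_(e \in E)
    h a * (f (gcomp y (ginv e)) * g (gcomp e (ginv a)))).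
  by apply: eq_fsbigr => e _; rewrite mulrA mulrC.
rewrite -fsbig_distrr // mulrC; congr (_ * _).
rewrite conv_fsupp gya.
transitivity (\sum_(e \in (fun b => gcomp b a) @` B a)
    f (gcomp y (ginv e)) * g (gcomp e (ginv a))).
  apply/esym/fsbig_widen.
    by move=> e eB; exists a.
  by move=> e [/Ey ey ne]; rewrite /= (EA e a) ?mulr0.
rewrite fsbig_image; last first.
  move=> b b'; rewrite !inE => -[bE _] [b'E _]; exact: gcompI.
apply: eq_fsbigr => b; rewrite inE => -[bE _].
by rewrite gcompK // gcomp_ginv_comp.
Qed.

End Convolution.

(** * The groupoid algebra and its diagonal *)

Section Algebra.
Context (R : comPzRingType) (Gr : topGroupoid).
Context (hG : ample Gr) (hhaus : hausdorff_space (garr Gr)).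
Implicit Types (f g h m d : garr Gr -> R) (a b y : garr Gr) (x : gobj Gr).

Let het : etale Gr := hG.1.
Let hobj : hausdorff_space (gobj Gr) := hG.2.1.

Lemma fsupp_open f : locally_constant f -> open (fsupp f).
Proof.
move=> fl; rewrite openE => y fy; apply: filterS (fl y) => z.
by rewrite /fsupp /= => ->.
Qed.

Lemma fsupp_closed f : locally_constant f -> closed (fsupp f).
Proof.
move=> fl; rewrite -openC openE => y fy; apply: filterS (fl y) => z.
by rewrite /fsupp /= => ->.
Qed.

Lemma fsupp_compact f : groupoid_algebra f -> compact (fsupp f).
Proof. by move=> [/fsupp_closed /closure_id {2}->]. Qed.

Lemma groupoid_algebraP f :
  locally_constant f -> compact (fsupp f) -> groupoid_algebra f.
Proof.
by move=> fl fc; split=> //; rewrite -(closure_id _).1 //; apply: fsupp_closed.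
Qed.

Lemma fiber_closed x : closed (@fiber Gr x).
Proof.
have -> : fiber x = @gdom Gr @^-1` [set x] by [].
apply: preimage_closed; first by move=> ? _; exact: gdom_continuous.
by apply: compact_closed hobj _; exact: compact_set1.
Qed.

(** The support meets a closed fiber in a compact set, and a local section through an arrow isolates
    it in its fiber, so this set is also discrete. *)
Lemma groupoid_algebra_finite_fibers g :
  groupoid_algebra g -> finite_fibers g.
Proof.
move=> /fsupp_compact gc x; apply: compact_discrete_finite.
  rewrite setIC; apply: compact_closedI => //; exact: fiber_closed.
move=> a [ax _]; have [s [sa _ _ sd]] := local_section_ex het a.
by apply: filterS sd => b sb [bx _]; rewrite -[LHS]sb -[RHS]sa bx -ax.
Qed.

Lemma conv_locally_constant f g : groupoid_algebra f -> groupoid_algebra g ->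
  locally_constant (conv f g).
Proof.
move=> [fl _] ga y0; have [gl _] := ga.
have Afin := groupoid_algebra_finite_fibers ga (gdom y0).
set A := fiber _ `&` _ in Afin.
have [s sP] := choice (local_section_ex het).
have near_dom a (P : set (gobj Gr)) : A a -> (\forall x \near gdom a, P x) ->
    \forall y \near y0, P (gdom y).
  by move=> [ay _] Pa; apply: gdom_continuous; rewrite -ay.
(* The five facts from here on make the map from [a] to [s a (gdom y)] a bijection from [A] onto the
   support of [g] over [gdom y] that preserves the summands. *)
have s_dom : \forall y \near y0, forall a, A a -> gdom (s a (gdom y)) = gdom y.
  apply: near_finite_forall => // a Aa; have [_ _ ds _] := sP a.
  exact: (near_dom a [set x | gdom (s a x) = x]).
have s_g : \forall y \near y0, forall a, A a -> g (s a (gdom y)) = g a.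
  apply: near_finite_forall => // a Aa; have [sa sc _ _] := sP a.
  apply: (near_dom a [set x | g (s a x) = g a]) => //.
  by apply: (sc [set b | g b = g a]); rewrite sa; exact: gl.
have s_f : \forall y \near y0, forall a, A a ->
    f (gcomp y (ginv (s a (gdom y)))) = f (gcomp y0 (ginv a)).
  apply: near_finite_forall => // a Aa; have [sa sc ds _] := sP a.
  have /subspace_continuousP/(_ (y0, ginv a)) gc := @gcomp_continuous Gr.
  have y0a : gdom y0 = gcod (ginv a) by rewrite gcod_inv Aa.1.
  have phic : (y, ginv (s a (gdom y))) @[y --> y0] --> (y0, ginv a).
    apply: cvg_pair => //.
    apply: (@cvg_comp _ _ _ (s a \o @gdom Gr) (@ginv Gr) _ (nbhs a)); last first.
      exact: ginv_continuous.
    apply: (@cvg_comp _ _ _ (@gdom Gr) (s a) _ (nbhs (gdom a))).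
      by rewrite Aa.1; exact: gdom_continuous.
    by have : s a x @[x --> gdom a] --> s a (gdom a) := sc; rewrite sa.
  (* Composition is continuous only within the composable pairs, so composability stays as a premise
     here; [ds] then removes it. *)
  have fy : \forall y \near y0, gdom y = gcod (ginv (s a (gdom y))) ->
      f (gcomp y (ginv (s a (gdom y)))) = f (gcomp y0 (ginv a)).
    exact: phic _ (gc y0a _ (fl (gcomp y0 (ginv a)))).
  apply: filterS2 fy (near_dom a [set x | gdom (s a x) = x] Aa ds) => y /= fy sy.
  by apply: fy; rewrite gcod_inv.
have s_inj : \forall y \near y0, forall a, A a -> forall a', A a' ->
    s a (gdom y) = s a' (gdom y) -> a = a'.
  apply: near_finite_forall => // a Aa; apply: near_finite_forall => // a' Aa'.
  have [->|aa'] := eqVneq a a'; first exact: nearW.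
  (* Distinct arrows have disjoint neighbourhoods, and continuity keeps the two sections inside
     them. *)
  move: hhaus; rewrite open_hausdorff => /(_ a a' aa').
  move=> [[U V] /= [Ua Va'] [Uo Vo /eqP UV]].
  have [sa sc _ _] := sP a; have [sa' sc' _ _] := sP a'.
  have Us := near_dom a [set x | U (s a x)] Aa.
  have Vs := near_dom a' [set x | V (s a' x)] Aa'.
  apply: filterS2 (Us _) (Vs _) => [y /= Uy Vy e||].
  - suff : (U `&` V) (s a (gdom y)) by rewrite UV.
    by split; rewrite // e.
  - by apply: (sc U); rewrite sa; apply: open_nbhs_nbhs; split=> //; rewrite inE in Ua.
  - by apply: (sc' V); rewrite sa'; apply: open_nbhs_nbhs; split=> //; rewrite inE in Va'.
have s_surj : \forall y \near y0, forall b, gdom b = gdom y -> g b != 0 ->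
    exists2 a, A a & s a (gdom y) = b.
  (* [S] is the part of the support of [g] off the regions where the sections invert [gdom]. It is
     compact, so its image under [gdom] is closed, and this image misses [gdom y0]; outside it,
     every arrow of the support lies on a section. *)
  pose S := fsupp g `&` ~` \bigcup_(a in A) [set b | s a (gdom b) = b]^°.
  have Sc : compact S.
    apply: compact_closedI; first exact: fsupp_compact.
    by apply: open_closedC; apply: bigcup_open => a _; exact: open_interior.
  have KS : closed (@gdom Gr @` S).
    apply: (compact_closed hobj); apply: continuous_compact => //.
    by apply: continuous_subspaceT; exact: gdom_continuous.
  have : \forall y \near y0, (~` (@gdom Gr @` S)) (gdom y).
    apply: gdom_continuous; apply: open_nbhs_nbhs; split; first by rewrite openC.
    move=> [a [ga0 nA] ay]; apply: nA; exists a => //.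
    by have [] := sP a.
  apply: filterS => y ny b dby gb; apply: contrapT => nb; apply: ny.
  exists b => //; split=> // -[a Aa] /interior_subset /= sab.
  by apply: nb; exists a; rewrite // -dby.
near=> y.
have dom_y := near s_dom y; have g_y := near s_g y.
have f_y := near s_f y; have inj_y := near s_inj y.
have surj_y := near s_surj y.
have As : fiber (gdom y) `&` fsupp g = (fun a => s a (gdom y)) @` A.
  apply/seteqP; split=> [b [bx gb]|_ [a Aa <-]].
    by have [|a Aa <-] := surj_y _ b bx gb; [|exists a].
  split; first exact: dom_y.
  by rewrite /fsupp /= g_y //; case: Aa.
rewrite !conv_fsupp As fsbig_image; last first.
  by move=> a a'; rewrite !inE => Aa Aa'; exact: inj_y.
by apply: eq_fsbigr => a; rewrite inE => Aa; rewrite f_y ?g_y.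
Unshelve. all: by end_near.
Qed.

(** The support of the product is closed and lies in the image, under composition, of the composable
    pairs of support arrows; these pairs form a compact set because composability is a closed
    condition. *)
Lemma groupoid_algebra_conv f g : groupoid_algebra f -> groupoid_algebra g ->
  groupoid_algebra (conv f g).
Proof.
move=> fa ga; have fgl := conv_locally_constant fa ga.
apply: groupoid_algebraP => //.
pose C : set (garr Gr * garr Gr) := [set p | gdom p.1 = gcod p.2].
have Cc : closed C.
  apply: closed_equalizer => // p.
    apply: (@cvg_comp _ _ _ fst (@gdom Gr)); first exact: cvg_fst.
    exact: gdom_continuous.
  apply: (@cvg_comp _ _ _ snd (@gcod Gr)); first exact: cvg_snd.
  exact: gcod_continuous.
pose P := (fsupp f `*` fsupp g) `&` C.
have Pc : compact P.
  by apply: compact_closedI => //; apply: compact_setX; exact: fsupp_compact.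
apply: (subclosed_compact (fsupp_closed fgl)
          (B := (fun p => gcomp p.1 p.2) @` P)).
  apply: continuous_compact => //.
  by apply: continuous_subspaceW (@gcomp_continuous Gr); exact: subIsetr.
move=> y /conv_neq0 [a [ay fy ga0]].
exists (gcomp y (ginv a), a); last by rewrite /= gcompVK.
by split; [split|rewrite /C /= gdom_comp ?gcod_inv ?gdom_inv].
Qed.

Lemma diagonal_gid d y : diagonal d -> d y != 0 -> gid (gdom y) = y.
Proof. by move=> [_ dD] /dD [x _ <-]; rewrite gdom_id. Qed.

(** As [d] vanishes off the units, only the unit at [gdom y] contributes to the sum. *)
Lemma conv_diagonalr f d y : diagonal d ->
  conv f d y = f y * d (gid (gdom y)).
Proof.
move=> dD; transitivity (\sum_(a \in [set gid (gdom y)]) f (gcomp y (ginv a)) * d a);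
  last by rewrite fsbig_set1 gcomp_unit_inv.
apply/esym/fsbig_widen; first by move=> _ -> /=; rewrite gdom_id.
move=> a [/= ay na]; apply: contrapT => /eqP fd; apply: na.
by rewrite -ay (diagonal_gid dD) //; apply: contra_neq fd => ->; rewrite mulr0.
Qed.

(** Only a = y contributes, since y a^-1 is a unit for no other arrow. *)
Lemma conv_diagonall d f y : diagonal d ->
  conv d f y = d (gid (gcod y)) * f y.
Proof.
move=> dD; transitivity (\sum_(a \in [set y]) d (gcomp y (ginv a)) * f a);
  last by rewrite fsbig_set1 gcomp_invr.
apply/esym/fsbig_widen; first by move=> _ -> /=.
move=> a [/= ay na]; apply: contrapT => /eqP df; apply: na.
have /(diagonal_gid dD) : d (gcomp y (ginv a)) != 0.
  by apply: contra_neq df => ->; rewrite mul0r.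
by move=> /esym /gid_gcomp_inv ->.
Qed.

Lemma diagonal_conv d d' : diagonal d -> diagonal d' -> diagonal (conv d d').
Proof.
move=> dD d'D; split; first by apply: groupoid_algebra_conv; [case: dD|case: d'D].
move=> y; rewrite /fsupp /= conv_diagonalr // => dy.
exists (gdom y) => //; apply: (diagonal_gid dD).
by apply: contra_neq dy => ->; rewrite mul0r.
Qed.

(** Where [d y] is nonzero, [y] is a unit, so its domain and range agree and commutativity of [R]
    suffices; elsewhere both sides vanish. *)
Lemma diagonal_convC d d' : diagonal d -> diagonal d' -> conv d d' = conv d' d.
Proof.
move=> dD d'D; apply/funext => y.
rewrite conv_diagonalr // conv_diagonall // mulrC.
have [->|dy] := eqVneq (d y) 0; first by rewrite !mulr0.
suff -> : gcod y = gdom y by [].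
by rewrite -(diagonal_gid dD dy) gdom_id gcod_id.
Qed.

(** The witness is the indicator function of the units at the domains of the support of [m]. This
    set is compact, hence closed in the Hausdorff arrow space, and it is open because [gdom] is an
    open map and the units form an open set. *)
Lemma diagonal_local_unit m : groupoid_algebra m ->
  exists2 e, diagonal e & conv m e = m.
Proof.
move=> ma; have [ml _] := ma.
pose K := @gdom Gr @` fsupp m.
have Kc : compact K.
  apply: continuous_compact; last exact: fsupp_compact.
  by apply: continuous_subspaceT; exact: gdom_continuous.
have gKc : compact (@gid Gr @` K).
  apply: continuous_compact => //.
  by apply: continuous_subspaceT; exact: gid_continuous.
have gKcl : closed (@gid Gr @` K) by exact: compact_closed.
have gKo : open (@gid Gr @` K).
  have -> : @gid Gr @` K = range (@gid Gr) `&` @gdom Gr @^-1` K.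
    apply/seteqP; split=> [_ [x Kx <-]|_ [[x _ <-]]]; last first.
      by rewrite /= gdom_id => Kx; exists x.
    by split; [exists x|rewrite /= gdom_id].
  apply: openI; first exact: range_gid_open.
  apply: open_comp; first by move=> ? _; exact: gdom_continuous.
  by apply: gdom_open => //; exact: fsupp_open.
pose e y : R := (y \in @gid Gr @` K)%:R.
have el : locally_constant e.
  move=> y; rewrite /e; case: (boolP (y \in _)) => yK.
    rewrite inE in yK; move: gKo; rewrite openE => /(_ _ yK).
    by apply: filterS => z zK; rewrite mem_set.
  rewrite notin_setE in yK; move: gKcl; rewrite -openC openE => /(_ _ yK).
  by apply: filterS => z zK; rewrite memNset.
have eK : fsupp e `<=` @gid Gr @` K.
  by move=> y; rewrite /fsupp /e /=; case: (boolP (y \in _)); rewrite ?eqxx ?inE.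
have eD : diagonal e.
  split; last by move=> y /eK [x _ <-]; exists x.
  apply: groupoid_algebraP => //.
  exact: subclosed_compact (fsupp_closed el) gKc eK.
exists e => //; apply/funext => y; rewrite conv_diagonalr //.
have [->|my] := eqVneq (m y) 0; first by rewrite mul0r.
by rewrite /e mem_set ?mulr1 //; exists (gdom y) => //; exists y.
Qed.

End Algebra.

(** * The graded normalizer *)

Section Normalizer.
Context (R : comPzRingType) (Gr : topGroupoid) (G : groupType).
Context (c : garr Gr -> G) (hc : cocycle c).
Context (hG : ample Gr) (hhaus : hausdorff_space (garr Gr)).
Implicit Types (k m n d e : garr Gr -> R) (g h : G).

Local Notation "m ** n" := (conv m n) (at level 40, left associativity).

Let convGA k m n : groupoid_algebra m -> groupoid_algebra n ->
  k ** (m ** n) = k ** m ** n.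
Proof.
by move=> mA nA; apply: convA; exact: groupoid_algebra_finite_fibers.
Qed.

Let convGS m n : groupoid_algebra m -> groupoid_algebra n ->
  groupoid_algebra (m ** n).
Proof. exact: groupoid_algebra_conv. Qed.

Let diagonal_alg d : diagonal d -> groupoid_algebra d.
Proof. by case. Qed.

Lemma homogeneous_conv g h m n :
  homogeneous c g m -> homogeneous c h n -> homogeneous c (g * h)%g (m ** n).
Proof.
move=> [mA mg] [nA nh]; split; first exact: convGS.
move=> y /conv_neq0 [a [ay my na]] /=.
have [_ _ cM] := hc.
rewrite -(gcompVK (esym ay)) cM ?(mg _ my) ?(nh _ na) //.
by rewrite gdom_comp ?gcod_inv ?gdom_inv.
Qed.

(** Exposes the witness in [normalizer_at], so that its symmetry with [m] and its behaviour under
    products can be stated. *)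
Definition normalizer_pair g m m' :=
  [/\ homogeneous c g m /\ homogeneous c (g^-1)%g m',
      m ** m' ** m = m, m' ** m ** m' = m',
      forall d, diagonal d -> diagonal (m ** d ** m')
    & forall d, diagonal d -> diagonal (m' ** d ** m)].

Lemma normalizer_atP g m :
  normalizer_at c g m <-> exists m', normalizer_pair g m m'.
Proof.
split=> [[mg [m' [m'g mm'm m'mm' mD]]]|[m' [[mg m'g] mm'm m'mm' mD m'D]]].
  by exists m'; split=> // d dD; apply: mD; [left|right]; exists d.
split=> //; exists m'; split=> // _ [] [d dD <-]; [exact: mD|exact: m'D].
Qed.

Lemma normalizer_pair_sym g m m' :
  normalizer_pair g m m' -> normalizer_pair (g^-1)%g m' m.
Proof. by move=> [[mg m'g] ? ? ? ?]; split=> //; rewrite invgK. Qed.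

Lemma normalizer_pair_diagonal g m m' :
  normalizer_pair g m m' -> diagonal (m ** m').
Proof.
move=> [[[mA _] _] _ _ mD _].
by have [e eD {1}<-] := diagonal_local_unit hG hhaus mA; exact: mD.
Qed.

(** The left side regroups as m(nn')(m'm)n; swapping the two middle factors gives (mm'm)(nn'n). *)
Lemma conv_regular m m' n n' :
  groupoid_algebra m -> groupoid_algebra m' ->
  groupoid_algebra n -> groupoid_algebra n' ->
  m ** m' ** m = m -> n ** n' ** n = n ->
  (m' ** m) ** (n ** n') = (n ** n') ** (m' ** m) ->
  (m ** n) ** (n' ** m') ** (m ** n) = m ** n.
Proof.
move=> mA m'A nA n'A mm'm nn'n C.
transitivity (m ** ((n ** n') ** (m' ** m)) ** n).
  by rewrite !convGA //; do ?apply: convGS.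
rewrite -C; transitivity ((m ** m' ** m) ** (n ** n' ** n)).
  by rewrite !convGA //; do ?apply: convGS.
by rewrite mm'm nn'n.
Qed.

Lemma normalizer_pair_conv g h m m' n n' :
  normalizer_pair g m m' -> normalizer_pair h n n' ->
  normalizer_pair (g * h)%g (m ** n) (n' ** m').
Proof.
move=> mP nP.
have pD := normalizer_pair_diagonal (normalizer_pair_sym mP).
have qD := normalizer_pair_diagonal nP.
have pqC := diagonal_convC pD qD.
have [[mg m'g] mm'm m'mm' mD m'D] := mP.
have [[nh n'h] nn'n n'nn' nD n'D] := nP.
have [mA _] := mg; have [m'A _] := m'g; have [nA _] := nh; have [n'A _] := n'h.
have pA := diagonal_alg pD; have qA := diagonal_alg qD.
have mnA := convGS mA nA; have n'm'A := convGS n'A m'A.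
split.
- split; first exact: homogeneous_conv.
  by rewrite invgM; exact: homogeneous_conv.
- exact: conv_regular.
- by apply: conv_regular => //; rewrite pqC.
(* Conjugation by mn is nested: (mn)d(n'm') = m(ndn')m'. *)
- move=> d dD; have dA := diagonal_alg dD.
  rewrite convGA // -[m ** n ** d]convGA; [|by []..].
  rewrite -[m ** _ ** n']convGA; [|exact: convGS|by []].
  by apply: mD; exact: nD.
- move=> d dD; have dA := diagonal_alg dD.
  rewrite convGA // -[n' ** m' ** d]convGA; [|by []..].
  rewrite -[n' ** _ ** m]convGA; [|exact: convGS|by []].
  by apply: n'D; exact: m'D.
Qed.

Lemma normalizer_idempotent_diagonal g e :
  normalizer_at c g e -> e ** e = e -> diagonal e.
Proof.
move=> /normalizer_atP[f fP] ee.
have efD := normalizer_pair_diagonal fP.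
have feD := normalizer_pair_diagonal (normalizer_pair_sym fP).
have [[[eA _] [fA _]] efe fef _ _] := fP.
have efC := diagonal_convC efD feD.
have fE : f = (f ** e) ** (e ** f).
  by rewrite convGA // -[f ** e ** e]convGA // ee fef.
have fD : diagonal f by rewrite fE; exact: diagonal_conv.
have ff : f ** f = f.
  have idem (p q : garr Gr -> R) : diagonal p -> diagonal q -> p ** p = p -> q ** q = q ->
      (p ** q) ** (p ** q) = p ** q.
    move=> pD qD pp qq.
    have pA := diagonal_alg pD; have qA := diagonal_alg qD.
    rewrite -convGA //; last exact: convGS.
    rewrite [q ** _]convGA // (diagonal_convC qD pD) -convGA // qq.
    by rewrite convGA // pp.
  by rewrite fE; apply: idem; rewrite // convGA ?fef ?efe //; exact: convGS.
(* Now that [f] is idempotent, e = efe = (ef)(fe). *)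
have eE : e = (e ** f) ** (f ** e).
  by rewrite convGA // -[e ** f ** f]convGA // ff efe.
by rewrite eE; exact: diagonal_conv.
Qed.

Lemma graded_normalizer_inverse_semigroup :
  inverse_semigroup (graded_normalizer (R := R) c) (@conv R Gr).
Proof.
have NA m : graded_normalizer c m -> groupoid_algebra m.
  by move=> [g _ [[]]].
apply: commuting_idempotents_inverse_semigroup.
- move=> m n [g _ /normalizer_atP[m' mP]] [h _ /normalizer_atP[n' nP]].
  exists (g * h)%g => //; apply/normalizer_atP; exists (n' ** m').
  exact: normalizer_pair_conv.
- by move=> k m n _ /NA mA /NA nA; exact: convGA.
- move=> m [g _ /normalizer_atP[m' mP]]; have [_ mm'm m'mm' _ _] := mP.
  exists m'; split=> //; exists (g^-1)%g => //; apply/normalizer_atP.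
  by exists m; exact: normalizer_pair_sym.
- move=> e f [g _ eN] [h _ fN] ee ff; apply: diagonal_convC.
    exact: normalizer_idempotent_diagonal eN ee.
  exact: normalizer_idempotent_diagonal fN ff.
Qed.

(** Zero has empty support, so it is homogeneous of every degree, and degree 1 is an arbitrary
    choice; zero is attached to itself. *)
Lemma normalizer_at0 : normalizer_at c 1%g (fun=> 0 : R).
Proof.
have zA : groupoid_algebra (fun=> 0 : R) (Gr := Gr).
  have z0 : fsupp (fun=> 0 : R) = set0 :> set (garr Gr).
    by apply/seteqP; split=> // y; rewrite /fsupp /= eqxx.
  split; first by move=> y; exact: nearW.
  by rewrite z0 closure0; exact: compact0.
have zS (A : set (garr Gr)) : fsupp (fun=> 0 : R) `<=` A.
  by move=> y; rewrite /fsupp /= eqxx.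
split; first by split.
exists (fun=> 0); rewrite !conv0f; split=> //.
by move=> _ [] [d _ <-]; rewrite convf0; split.
Qed.

End Normalizer.

Theorem proposition4p2 (G : groupType) (R : comPzRingType) (Gr : topGroupoid)
    (c : garr Gr -> G) (hc : cocycle c) (hample : ample Gr)
    (hhaus : hausdorff_space (garr Gr)) :
  exists theta : (garr Gr -> R) -> G,
    graded_inverse_semigroup (graded_normalizer c) (@conv R Gr)
      (fun=> 0) theta /\
    forall g m, normalizer_at c g m -> m <> (fun=> 0) -> theta m = g.
Proof.
(* A nonzero [m] has a single degree, the value of [c] at any arrow of its support, so [theta] can
   be chosen element by element, with default 1 off the normalizer. *)
have theta_ex (m : garr Gr -> R) :
    exists t, forall g, normalizer_at c g m -> m <> (fun=> 0) -> t = g.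
  have [[g mg]|nm] := pselect (exists g, normalizer_at c g m); last first.
    by exists 1%g => g mg; case: nm; exists g.
  exists g => h [[_ mh] _] m0; have [[_ mg'] _] := mg.
  have [y my] : exists y, m y != 0.
    apply: contrapT => ny; apply: m0; apply/funext => y.
    by apply: contrapT => /eqP my; apply: ny; exists y.
  by rewrite -(mg' _ my) (mh _ my).
have [theta thetaE] := choice theta_ex.
exists theta; split; last by move=> g m; exact: thetaE.
split.
- exact: graded_normalizer_inverse_semigroup.
- by exists 1%g => //; exact: normalizer_at0.
- by move=> s _; rewrite conv0f convf0.
- move=> s t [g _ sg] [h _ th] st0.
  (* Both factors of a nonzero product are nonzero, so [theta] is determined on them as well as on
     the product, which has degree gh. *)
  have s0 : s <> (fun=> 0) by move=> s0; apply: st0; rewrite s0 conv0f.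
  have t0 : t <> (fun=> 0) by move=> t0; apply: st0; rewrite t0 convf0.
  have [s' sP] := (normalizer_atP c g s).1 sg.
  have [t' tP] := (normalizer_atP c h t).1 th.
  rewrite (thetaE _ _ sg s0) (thetaE _ _ th t0); apply: thetaE st0.
  apply/normalizer_atP; exists (conv t' s').
  exact: normalizer_pair_conv.
Qed.
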